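(* Let $G=(V,E)$ be an unweighted, undirected simple graph with $\#V=n$, and write $V=\{1,\dots,n\}$, $\deg_i=\#\{j\in V:\{i,j\}\in E\}$. (1) The independence number of $G$ satisfies $$\alpha(G)=\max_{\vec x\in\mathbb{R}^n\setminus\{\vec 0\}}\frac{\sum_{\{i,j\}\in E}\big(|x_i-x_j|+|x_i+x_j|\big)-2\sum_{i\in V}(\deg_i-1)|x_i|}{2\|\vec x\|_\infty}.$$ (2) For $\vec x=(x_{ki})_{k,i\in V}\in\mathbb{R}^{n^2}$ write $\vec x^{k}=(x_{k1},\dots,x_{kn})$ and $\vec x^{,k}=(x_{1k},\dots,x_{nk})$. The chromatic number of $G$ satisfies $$\gamma(G)=n^2-\max_{\vec x\in\mathbb{R}^{n^2}\setminus\{\vec 0\}}\sum_{k\in V}\frac{n\sum_{\{i,j\}\in E}\big(|x_{ki}-x_{kj}|+|x_{ki}+x_{kj}|\big)+2n\|\vec x^{,k}\|_\infty-2n\deg_k\|\vec x^{,k}\|_1-2\|\vec x^{k}\|_\infty}{2\|\vec x\|_\infty}.$$ (3) The maximum matching number of $G$ (maximum number of pairwise vertex-disjoint edges) equals $$\max_{\vec y\in\mathbb{R}^E\setminus\{\vec 0\}}\frac{\|\vec y\|_1^2}{\|\vec y\|_1^2-2\sum_{\{e,e'\}:\,e\cap e'=\varnothing}y_ey_{e'}},$$ where the sum runs over unordered pairs $\{e,e'\}$ of distinct edges of $G$ that share no vertex.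
   Context: $\|\cdot\|_\infty$ and $\|\cdot\|_1$ denote the usual max-norm and $\ell^1$-norm; in (2), $\|\vec x\|_\infty=\max_{k,i}|x_{ki}|$. *)

(* Defs.v *)
From mathcomp Require Import all_boot all_order all_algebra.
From mathcomp Require Import boolp classical_sets reals matrix_normedtype.

Set Implicit Arguments.
Unset Strict Implicit.
Unset Printing Implicit Defensive.

Import Order.TTheory GRing.Theory Num.Theory.
Local Open Scope ring_scope.

Record sgraph (n : nat) := SGraph {
  edges : {set {set 'I_n}};
  card_edge : forall A, A \in edges -> #|A| = 2%N
}.

(* Irreflexive because [set i; i] has only one element. *)
Definition adj n (G : sgraph n) : rel 'I_n :=
  fun i j => [set i; j]%SET \in edges G.

Lemma adj_irrefl n (G : sgraph n) (i : 'I_n) : adj G i i = false.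
Proof. by apply/negP => /card_edge; rewrite cards2 eqxx. Qed.

Definition deg n (G : sgraph n) (i : 'I_n) : nat :=
  #|[set j | adj G i j]%SET|.

Definition independent n (G : sgraph n) (S : {set 'I_n}) : bool :=
  [forall i in S, forall j in S, ~~ adj G i j].

Definition independence_number n (G : sgraph n) : nat :=
  \max_(S : {set 'I_n} | independent G S) #|S|.

Definition colorable n (G : sgraph n) (k : nat) : bool :=
  [exists c : {ffun 'I_n -> 'I_k},
     forall i, forall j, adj G i j ==> (c i != c j)].

Lemma ex_colorable n (G : sgraph n) : exists k, colorable G k.
Proof.
exists n; apply/existsP; exists [ffun i => i].
apply/forallP => i; apply/forallP => j; apply/implyP => ij; rewrite !ffunE.
by apply/eqP => eq_ij; rewrite eq_ij adj_irrefl in ij.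
Qed.

Definition chromatic_number n (G : sgraph n) : nat := ex_minn (ex_colorable G).

Definition is_matching n (G : sgraph n) (M : {set {set 'I_n}}) : bool :=
  (M \subset edges G) &&
  [forall e in M, forall e' in M, (e != e') ==> [disjoint e & e']].

Definition matching_number n (G : sgraph n) : nat :=
  \max_(M : {set {set 'I_n}} | is_matching G M) #|M|.

(* Sum over unordered edges of a symmetric f, each edge {i, j} being counted
   once, through its endpoints in increasing order. *)
Definition edge_sum (R : realType) n (G : sgraph n) (f : 'I_n -> 'I_n -> R) : R :=
  \sum_(i < n) \sum_(j < n | (i < j)%N && adj G i j) f i j.

(* Entrywise l^1 norm; the entrywise max norm is the library's [mx_norm]. *)
Definition norm1 (R : realType) m n (x : 'M[R]_(m, n)) : R :=
  \sum_i \sum_j `|x i j|.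

(* Attained maximum of F over the nonzero elements of V. *)
Definition is_max_nonzero (R : realType) (V : zmodType) (F : V -> R) (v : R) :
    Prop :=
  let A := [set F x | x in [set x | x != 0]]%classic in A v /\ ubound A v.

Definition alpha_objective (R : realType) n (G : sgraph n) (x : 'rV[R]_n) : R :=
  (edge_sum G (fun i j => `|x 0 i - x 0 j| + `|x 0 i + x 0 j|)
   - 2 * \sum_(i < n) ((deg G i)%:R - 1) * `|x 0 i|)
  / (2 * mx_norm x).

(* A vector (x_ki) of R^(n^2) is the matrix x with entries x k i, so that x^k is
   [row k x] and x^{,k} is [col k x]. *)
Definition gamma_objective (R : realType) n (G : sgraph n) (x : 'M[R]_n) : R :=
  \sum_(k < n)
    (n%:R * edge_sum G (fun i j => `|x k i - x k j| + `|x k i + x k j|)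
     + 2 * n%:R * mx_norm (col k x)
     - 2 * n%:R * (deg G k)%:R * norm1 (col k x)
     - 2 * mx_norm (row k x))
    / (2 * mx_norm x).

(* A vector y of R^E is a row vector whose a-th coordinate is that of the edge
   [enum_val a]; unordered pairs of distinct edges are pairs a < b. *)
Definition matching_objective (R : realType) n (G : sgraph n)
    (y : 'rV[R]_#|edges G|) : R :=
  norm1 y ^+ 2 /
  (norm1 y ^+ 2
   - 2 * \sum_(a < #|edges G|)
           \sum_(b < #|edges G|
                 | (a < b)%N && [disjoint enum_val a & enum_val b])
             y 0 a * y 0 b).

(* Main.v *)
(* With |a - b| + |a + b| = 2 |a| + 2 |b| - 2 min(|a|, |b|) and the handshake
   identity, the objectives of (1) and (2) become combinations of sums, minima
   over edges and maxima of the entries |x_i|, divided by the max-norm. All these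
   functionals are additive along the decomposition of a nonnegative vector into
   its level-set indicators (a discrete coarea formula), so it suffices to bound
   them on 0/1 vectors, where the bounds are combinatorial: |S| is at most
   alpha(G) plus the number of edges inside S, and a family of n vertex sets
   either has at least chi(G) nonempty members, misses a vertex, or has a member
   that contains an edge, the last two defects each costing n >= chi(G).
   Part (3) is the Motzkin-Straus theorem for the graph on E in which two edges
   are adjacent when they are disjoint, whose cliques are the matchings of G. *)

Require Import Defs.
From mathcomp Require Import all_boot all_order all_algebra.
From mathcomp Require Import boolp classical_sets reals matrix_normedtype.
From mathcomp Require Import ring lra.
Import Order.TTheory GRing.Theory Num.Theory.
Local Open Scope ring_scope.

Set Implicit Arguments.
Unset Strict Implicit.
Unset Printing Implicit Defensive.

(** * Additivity over level sets *)

Lemma bigmax_indicator (R : realType) (J : finType) (b : pred J) :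
  \big[Num.max/0]_j (b j)%:R = [exists j, b j]%:R :> R.
Proof.
have [/existsP[j bj]|/existsPn nb] := boolP [exists j, b j].
  apply/le_anti/andP; split; first by apply: bigmax_le => // k _; case: (b k).
  by have := le_bigmax 0 (fun k => (b k)%:R : R) j; rewrite bj.
rewrite (eq_bigr (fun=> 0)) => [|k _]; last by rewrite (negPf (nb k)).
by elim/big_ind: _ => // x y -> ->; rewrite maxxx.
Qed.

(** Since [x] vanishes off [S], adding [m] on [S] slides a new bottom layer under [x] and preserves
    the order of the entries. Minima and maxima are not additive in general, but they are along such
    layers. *)
Definition layer_additive (R : realType) (I : finType) (f : (I -> R) -> R) :=
  forall (x : I -> R) (S : {set I}) (m : R), 0 <= m ->
    (forall i, 0 <= x i) -> (forall i, i \notin S -> x i = 0) ->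
  f (fun i => x i + m * (i \in S)%:R) = f x + m * f (fun i => (i \in S)%:R).

Section LayerAdditive.
Variables (R : realType) (I : finType).
Implicit Types (f g : (I -> R) -> R) (x : I -> R).

Lemma layer_additiveD f g :
  layer_additive f -> layer_additive g -> layer_additive (fun x => f x + g x).
Proof.
by move=> addf addg x S m m0 x0 xS; rewrite addf // addg // mulrDr addrACA.
Qed.

Lemma layer_additiveZ c f : layer_additive f -> layer_additive (fun x => c * f x).
Proof. by move=> addf x S m m0 x0 xS; rewrite addf // mulrDr mulrCA. Qed.

Lemma layer_additive_sum (J : finType) (P : pred J) (F : J -> (I -> R) -> R) :
  (forall j, layer_additive (F j)) ->
  layer_additive (fun x => \sum_(j | P j) F j x).
Proof.
move=> addF x S m m0 x0 xS; rewrite mulr_sumr -big_split /=.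
by apply: eq_bigr => j _; apply: addF.
Qed.

Lemma layer_additive_min i j :
  @layer_additive R I (fun x => Num.min (x i) (x j)).
Proof.
move=> x S m m0 x0 xS; have := x0 i; have := x0 j; move: (xS i) (xS j).
case: (i \in S) => [_|->//]; case: (j \in S) => [_|->//];
  rewrite /= ?minxx ?mulr1 ?mulr0 ?addr0 => xj xi.
- by rewrite addr_minl.
- rewrite !min_r ?ler01 ?addr_ge0 //; lra.
- rewrite !min_l ?ler01 ?addr_ge0 //; lra.
- by [].
Qed.

(** The map [h] selects the coordinates over which the maximum runs: all entries, one row or one
    column. If some selected coordinate lies in [S], the maximum rises by exactly [m]; otherwise
    nothing changes. *)
Lemma layer_additive_max (J : finType) (h : J -> I) :
  @layer_additive R I (fun x => \big[Num.max/0]_j x (h j)).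
Proof.
move=> x S m m0 x0 xS.
rewrite (bigmax_indicator R (fun j => h j \in S)).
have [/existsP[j hjS]|/existsPn hS] := boolP [exists j, h j \in S]; last first.
  rewrite mulr0 addr0; apply: eq_bigr => j _.
  by rewrite (negPf (hS j)) mulr0 addr0.
rewrite mulr1; apply/le_anti/andP; split.
  apply: bigmax_le => [|k _]; first by rewrite addr_ge0 // bigmax_ge_id.
  apply: lerD; first exact: (le_bigmax 0 (fun k => x (h k))).
  by case: (_ \in _); rewrite ?mulr1 ?mulr0.
have [k _ ->] := eq_bigmax j xpredT (fun k => x (h k)) isT (fun k _ => x0 (h k)).
have [hkS|hkS] := boolP (h k \in S).
  by have /= := le_bigmax 0 (fun k => x (h k) + m * (h k \in S)%:R) k;
    rewrite hkS /= mulr1.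
(* If a maximizer lies outside [S], the old maximum is 0, and the coordinate [h j] in [S] already
   reaches [m]. *)
have /= := le_bigmax 0 (fun k => x (h k) + m * (h k \in S)%:R) j.
rewrite (xS (h k)) // hjS /= mulr1; by apply: le_trans; rewrite lerD2r.
Qed.

(* Peel off the bottom layer: subtract from x its least positive value on the
   support S of x, which leaves a function with smaller support. *)
Lemma layer_additive_ge0 f : layer_additive f ->
  (forall S : {set I}, S != finset.set0 -> 0 <= f (fun i => (i \in S)%:R)) ->
  forall x, (forall i, 0 <= x i) -> 0 <= f x.
Proof.
move=> addf f_ind x; have [k] := ubnP #|[set i | x i != 0]|.
elim: k x => // k IH x; rewrite ltnS => supp_le x0.
set S := [set i | x i != 0] in supp_le.
have [S0|[i iS]] := finset.set_0Vmem S.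
  (* Adding an empty layer of height 1 to the zero function gives f 0 = f 0 + f 0. *)
  have f0 : f (fun=> 0) = 0.
    have := addf (fun=> 0) finset.set0 1 ler01 (fun=> lexx 0) (fun _ _ => erefl).
    have -> : (fun i => (i \in @finset.set0 I)%:R) = (fun=> 0) :> (I -> R).
      by apply/funext => i; rewrite inE.
    have -> : (fun i => 0 + 1 * (i \in @finset.set0 I)%:R) = (fun=> 0) :> (I -> R).
      by apply/funext => i; rewrite inE mulr0 addr0.
    by lra.
  have -> : x = fun=> 0.
    apply/funext => i; apply/eqP/negPn; have := finset.in_set0 i.
    by rewrite -S0 inE => ->.
  by rewrite f0.
have [j jS jmin] := arg_minP x iS.
pose y i := x i - x j * (i \in S)%:R.
have y0 l : 0 <= y l.
  rewrite /y; have [lS|lS] := boolP (l \in S); first by rewrite mulr1 subr_ge0 jmin.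
  by rewrite mulr0 subr0.
have yS l : l \notin S -> y l = 0.
  rewrite /y => lS; rewrite (negPf lS) mulr0 subr0.
  by move: lS; rewrite inE negbK => /eqP.
have -> : x = fun l => y l + x j * (l \in S)%:R by apply/funext => l; rewrite subrK.
rewrite addf // addr_ge0 ?mulr_ge0 //; last first.
  by apply: f_ind; apply/finset.set0Pn; exists i.
apply: IH => //; apply: leq_trans supp_le; apply/proper_card/properP; split.
  by apply/fintype.subsetP => l; rewrite inE; apply: contraNT => /yS ->.
have {}jS : j \in S := jS.
by exists j => //; rewrite inE /y jS mulr1 subrr eqxx.
Qed.

End LayerAdditive.

(** * The objectives as combinations of minima and maxima *)

Section Objectives.
Variables (R : realType) (n : nat) (G : sgraph n).

Lemma adjC : symmetric (adj G).
Proof. by move=> i j; rewrite /adj finset.setUC. Qed.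

(** Weighted handshake identity: the neighbours of [i] split into those above and those below [i],
    and the two halves account for the two endpoints of each edge. *)
Lemma edge_sum_add (x : 'I_n -> R) :
  edge_sum G (fun i j => x i + x j) = \sum_i (deg G i)%:R * x i.
Proof.
have degE i : (deg G i)%:R * x i = \sum_(j | adj G i j) x i.
  rewrite sumr_const mulr_natl /deg; congr (_ *+ _).
  by apply: eq_card => j; rewrite inE.
under [RHS]eq_bigr => i _ do rewrite degE (bigID (fun j : 'I_n => (i < j)%N)) /=.
rewrite /edge_sum big_split /=.
under eq_bigr do rewrite big_split /=.
rewrite big_split /=; congr (_ + _).
  by apply: eq_bigr => i _; apply: eq_bigl => j; rewrite andbC.
rewrite (exchange_big_dep xpredT) //=; apply: eq_bigr => j _; apply: eq_bigl => i.
rewrite adjC andbC -leqNgt; case: ltngtP => //= /val_inj ->.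
by rewrite adj_irrefl.
Qed.

Lemma edge_sum_abs (x : 'I_n -> R) :
  edge_sum G (fun i j => `|x i - x j| + `|x i + x j|) =
  2 * \sum_i (deg G i)%:R * `|x i|
  - 2 * edge_sum G (fun i j => Num.min `|x i| `|x j|).
Proof.
rewrite -(edge_sum_add (fun i => `|x i|)) /edge_sum -mulrBr -sumrB mulr_sumr.
apply: eq_bigr => i _; rewrite -sumrB mulr_sumr; apply: eq_bigr => j _.
move: (x i) (x j) => a b.
case: (ger0P a) => a0; case: (ger0P b) => b0;
case: (ger0P (a - b)) => c0; case: (ger0P (a + b)) => d0;
rewrite /Num.min; case: ltP => ?; lra.
Qed.

Lemma alpha_objectiveE (x : 'rV[R]_n) :
  alpha_objective G x =
  (\sum_i `|x 0 i| - edge_sum G (fun i j => Num.min `|x 0 i| `|x 0 j|))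
  / mx_norm x.
Proof.
rewrite /alpha_objective edge_sum_abs -mulrBr -mulrBr -mulf_div divff ?pnatr_eq0 //.
rewrite mul1r; congr (_ / _).
under [X in _ - X]eq_bigr do rewrite mulrBl mul1r.
rewrite sumrB; lra.
Qed.

Lemma gamma_objectiveE (x : 'M[R]_n) :
  gamma_objective G x =
  (n%:R * \sum_i mx_norm (col i x) - \sum_k mx_norm (row k x)
   - n%:R * \sum_k edge_sum G (fun i j => Num.min `|x k i| `|x k j|))
  / mx_norm x.
Proof.
rewrite /gamma_objective -mulr_suml.
have -> : \sum_k (n%:R * edge_sum G (fun i j => `|x k i - x k j| + `|x k i + x k j|)
     + 2 * n%:R * mx_norm (col k x)
     - 2 * n%:R * (deg G k)%:R * norm1 (col k x)
     - 2 * mx_norm (row k x)) =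
  2 * (n%:R * \sum_i mx_norm (col i x) - \sum_k mx_norm (row k x)
   - n%:R * \sum_k edge_sum G (fun i j => Num.min `|x k i| `|x k j|)).
  (* The objective attaches degrees to columns, while the handshake identity yields them row by row;
     exchanging the sums makes them cancel. *)
  have E : \sum_k (deg G k)%:R * norm1 (col k x) =
           \sum_k \sum_i (deg G i)%:R * `|x k i|.
    rewrite exchange_big /=; apply: eq_bigr => k _; rewrite mulr_sumr.
    by apply: eq_bigr => i _; rewrite big_ord1 mxE.
  under eq_bigr do rewrite edge_sum_abs mulrBr -!mulrA.
  rewrite !(sumrB, big_split) /= -!mulr_sumr E; lra.
by rewrite -mulf_div divff ?pnatr_eq0 // mul1r.
Qed.

Lemma layer_additive_edge_sum (I : finType) (h : 'I_n -> I) :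
  layer_additive (fun x : I -> R =>
    edge_sum G (fun i j => Num.min (x (h i)) (x (h j)))).
Proof.
by do 2![apply: layer_additive_sum => ?]; apply: layer_additive_min.
Qed.

End Objectives.

Lemma mx_norm_gt0 (R : realType) m n (x : 'M[R]_(m, n)) : x != 0 -> 0 < mx_norm x.
Proof.
move=> x_neq0; rewrite lt_neqAle mx_normrE bigmax_ge_id andbT eq_sym -mx_normrE.
by apply: contra_neq x_neq0 => /mx_norm_eq0.
Qed.

(** * Indicator vectors *)

Lemma sum_indicator (R : realType) (I : finType) (S : {set I}) :
  \sum_i (i \in S)%:R = #|S|%:R :> R.
Proof. by rewrite -natr_sum -sum1_card [in RHS]big_mkcond. Qed.

Section Indicator.
Variables (R : realType) (n : nat) (G : sgraph n).

Lemma min_indicator_ge0 (b c : bool) : 0 <= Num.min b%:R c%:R :> R.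
Proof. by rewrite le_min !ler0n. Qed.

Lemma edge_sum_indicator_ge0 (S : pred 'I_n) :
  0 <= edge_sum G (fun i j => Num.min (S i)%:R (S j)%:R) :> R.
Proof. by do 2!apply: sumr_ge0 => ? _; apply: min_indicator_ge0. Qed.

Lemma edge_sum_indicator_ge1 (S : pred 'I_n) i j : adj G i j -> S i -> S j ->
  1 <= edge_sum G (fun i j => Num.min (S i)%:R (S j)%:R) :> R.
Proof.
wlog ij : i j / (i < j)%N => [H Gij Si Sj|Gij Si Sj].
  have [ij|ji|/val_inj ij] := ltngtP i j; first exact: (H i j).
    by apply: (H j i) => //; rewrite adjC.
  by rewrite ij adj_irrefl in Gij.
rewrite /edge_sum (bigD1 i) //= (bigD1 j) ?ij //= Si Sj minxx -addrA lerDl.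
by rewrite addr_ge0 // ?sumr_ge0 // => *; rewrite ?sumr_ge0 // => *;
  apply: min_indicator_ge0.
Qed.

(* Deleting from S the smaller endpoint of each edge inside S leaves an
   independent set. *)
Lemma card_le_independence_number (S : {set 'I_n}) :
  #|S|%:R <= (independence_number G)%:R
             + edge_sum G (fun i j => Num.min (i \in S)%:R (j \in S)%:R) :> R.
Proof.
pose T := [set i in S | [forall j in S, (i < j)%N ==> ~~ adj G i j]]%SET.
have indT : independent G T.
  apply/forall_inP => i iT; apply/forall_inP => j jT; apply/negP => Gij.
  move: iT jT; rewrite !inE => /andP[iS /forall_inP iT] /andP[jS /forall_inP jT].
  have [ij|ji|/val_inj ij] := ltngtP i j.
  - by have := iT j jS; rewrite ij Gij.
  - by have := jT i iS; rewrite ji adjC Gij.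
  - by rewrite ij adj_irrefl in Gij.
have : #|T|%:R <= (independence_number G)%:R :> R.
  by rewrite ler_nat; exact: (@leq_bigmax_cond _ _ (fun A : {set 'I_n} => #|A|) T).
rewrite -lerBlDr => /(le_trans _); apply; rewrite lerBlDr.
(* The comparison with [T] is made vertex by vertex, each edge inside [S] being charged to its
   smaller endpoint. *)
rewrite -!sum_indicator -big_split /=; apply: ler_sum => i _.
have [iS|_] := boolP (i \in S); last first.
  by rewrite addr_ge0 ?sumr_ge0 // => *; apply: (min_indicator_ge0 false).
have [iT|] := boolP (i \in T).
  by rewrite lerDl sumr_ge0 // => *; apply: (min_indicator_ge0 true).
rewrite inE iS /= add0r => /forall_inPn[j jS]; rewrite negb_imply negbK => ijG.
rewrite (bigD1 j) //= jS minxx lerDl sumr_ge0 // => *.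
exact: (min_indicator_ge0 true).
Qed.

Lemma chromatic_number_le k : colorable G k -> (chromatic_number G <= k)%N.
Proof. by rewrite /chromatic_number; case: ex_minnP => m _; apply. Qed.

Lemma chromatic_number_colorable : colorable G (chromatic_number G).
Proof. by rewrite /chromatic_number; case: ex_minnP. Qed.

Lemma chromatic_number_le_card : (chromatic_number G <= n)%N.
Proof.
apply: chromatic_number_le; apply/existsP; exists [ffun i => i].
apply/forallP => i; apply/forallP => j; apply/implyP => ij; rewrite !ffunE.
by apply: contraTneq ij => ->; rewrite adj_irrefl.
Qed.

Lemma chromatic_number_le_image (I : finType) (K : {set I}) (c : 'I_n -> I) :
  (forall i, c i \in K) -> (forall i j, adj G i j -> c i != c j) ->
  (chromatic_number G <= #|K|)%N.
Proof.
move=> cK cP; apply: chromatic_number_le; apply/existsP.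
exists [ffun i => enum_rank_in (cK i) (c i)].
apply/forallP => i; apply/forallP => j; apply/implyP => /cP; rewrite !ffunE.
by apply: contra_neq => /(congr1 enum_val); rewrite !enum_rankK_in.
Qed.

End Indicator.

(** * Independence number *)

(** The upper bound turns [v <= F x] into equality, so a witness need only be estimated from
    below. *)
Lemma is_max_nonzero_intro (R : realType) (V : zmodType) (F : V -> R) v x :
  x != 0 -> v <= F x -> (forall y, y != 0 -> F y <= v) -> is_max_nonzero F v.
Proof.
move=> x0 vF Fv; split => [|_ [y y0 <-]]; last exact: Fv.
by exists x => //; apply/le_anti; rewrite Fv.
Qed.

Lemma alpha_objective_le (R : realType) n (G : sgraph n) (x : 'rV[R]_n) :
  x != 0 -> alpha_objective G x <= (independence_number G)%:R.
Proof.
move=> /mx_norm_gt0 x_gt0; rewrite alpha_objectiveE ler_pdivrMr // -subr_ge0.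
(* Bound minus objective, with the norm cleared. Indexing by pairs matches the entries over which
   [mx_norm] ranges. *)
pose f (u : 'I_1 * 'I_n -> R) := (independence_number G)%:R * \big[Num.max/0]_p u p
  + (edge_sum G (fun i j => Num.min (u (0, i)) (u (0, j)))
     + (-1) * \sum_i u (0, i)).
suff : 0 <= f (fun p => `|x p.1 p.2|).
  by rewrite /f mx_normrE /=; lra.
apply: layer_additive_ge0 => // [|S /finset.set0Pn[p pS]].
  apply: layer_additiveD; first exact/layer_additiveZ/layer_additive_max.
  apply: layer_additiveD; first exact: layer_additive_edge_sum.
  by apply: layer_additiveZ; apply: layer_additive_sum.
rewrite /f (bigmax_indicator R (fun p => p \in S)).
have -> : [exists p, p \in S] by apply/existsP; exists p.
have := card_le_independence_number R G [set i | (0, i) \in S]%SET.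
rewrite -sum_indicator.
have -> : edge_sum G (fun i j => Num.min (i \in [set i | (0, i) \in S]%SET)%:R
                                         (j \in [set i | (0, i) \in S]%SET)%:R)
    = edge_sum G (fun i j => Num.min ((0, i) \in S)%:R ((0, j) \in S)%:R) :> R.
  by do 2!apply: eq_bigr => ? _; rewrite !inE.
under eq_bigr do rewrite inE.
rewrite /= mulr1; lra.
Qed.

Lemma indicator_mx_neq0 (R : realType) m n (b : 'I_m -> 'I_n -> bool) i j :
  b i j -> \matrix_(i, j) (b i j)%:R != 0 :> 'M[R]_(m, n).
Proof. by move=> bij; apply/matrix0Pn; exists i, j; rewrite mxE bij oner_eq0. Qed.

Lemma mx_norm_indicator (R : realType) m n (b : 'I_m -> 'I_n -> bool) :
  mx_norm (\matrix_(i, j) (b i j)%:R : 'M[R]_(m, n))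
  = [exists p, b p.1 p.2]%:R.
Proof.
rewrite mx_normrE -bigmax_indicator; apply: eq_bigr => p _.
by rewrite mxE normr_nat.
Qed.

(** The indicator of a maximum independent set attains the bound: it has norm 1 and no edge
    contributes a minimum. Singletons are independent, so this set is nonempty. *)
Lemma alpha_max (R : realType) n (G : sgraph n) : (0 < n)%N ->
  is_max_nonzero (@alpha_objective R n G) (independence_number G)%:R.
Proof.
move=> n_gt0.
have [|S indS cardS] := @eq_bigmax_cond _ (independent G) (fun S => #|S|).
  apply/card_gt0P; exists finset.set0; apply/forall_inP => i; by rewrite inE.
have ind1 : independent G [set Ordinal n_gt0]%SET.
  apply/forall_inP => i /set1P ->; apply/forall_inP => j /set1P ->.
  by rewrite adj_irrefl.
have := @leq_bigmax_cond _ (independent G) (fun S => #|S|) _ ind1.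
rewrite cards1 cardS => /card_gt0P[i iS].
apply: (@is_max_nonzero_intro _ _ _ _ (\matrix_(_, i) (i \in S)%:R)) => [||x].
- by apply: (@indicator_mx_neq0 _ _ _ (fun _ i => i \in S) 0 i iS).
- rewrite alpha_objectiveE (mx_norm_indicator R (fun _ i => i \in S)).
  have -> : [exists p : 'I_1 * 'I_n, p.2 \in S] by apply/existsP; exists (0, i).
  rewrite divr1 /edge_sum [X in _ - X]big1 => [|j _].
    rewrite subr0 /independence_number cardS -sum_indicator.
    by apply: ler_sum => j _; rewrite mxE normr_nat.
  apply: big1 => k /andP[_ jk]; rewrite !mxE !normr_nat.
  have [jS|_] := boolP (j \in S); last by rewrite min_l.
  have [kS|_] := boolP (k \in S); last by rewrite min_r.
  by move/forall_inP: indS => /(_ j jS) /forall_inP /(_ k kS); rewrite jk.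
exact: alpha_objective_le.
Qed.

(** * Chromatic number *)

(** Row [k] of [S] is read as a vertex set. Then [cov] counts the vertices covered by these sets,
    [rows] the nonempty sets, and [conf] the edges inside each set, summed over the sets. *)
Lemma gamma_indicator_le (R : realType) n (G : sgraph n) (S : {set 'I_n * 'I_n}) :
  n%:R * (\sum_i [exists k, (k, i) \in S]%:R : R)
  - \sum_k [exists i, (k, i) \in S]%:R
  - n%:R * \sum_k edge_sum G (fun i j => Num.min ((k, i) \in S)%:R ((k, j) \in S)%:R)
  <= n%:R ^+ 2 - (chromatic_number G)%:R.
Proof.
set conf := \sum_k edge_sum _ _; set cov := \sum_i _; set rows := \sum_k _.
have conf0 : 0 <= conf.
  by apply: sumr_ge0 => k _; apply: (edge_sum_indicator_ge0 R G (fun i => (k, i) \in S)).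
have rows0 : 0 <= rows by apply: sumr_ge0.
have n0 : 0 <= n%:R :> R by [].
have chi_le : (chromatic_number G)%:R <= n%:R :> R.
  by rewrite ler_nat chromatic_number_le_card.
have nconf0 : 0 <= n%:R * conf by rewrite mulr_ge0.
have covE : cov = #|[set i | [exists k, (k, i) \in S]]%SET|%:R.
  by rewrite -sum_indicator; apply: eq_bigr => i _; rewrite inE.
have [/forallP covered|] := boolP [forall i, exists k, (k, i) \in S]; last first.
  (* An uncovered vertex lowers n * [cov] by at least n, hence by at least the chromatic number. *)
  rewrite negb_forall => /existsP[i iNS].
  have : (#|[set i | [exists k, (k, i) \in S]]%SET| + 1 <= n)%N.
    rewrite addn1 -[X in (_ < X)%N]card_ord -cardsT; apply/proper_card.
    by apply/properP; split=> //; exists i; rewrite inE.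
  rewrite -(ler_nat R) natrD -covE => cov_le.
  have := ler_wpM2l n0 cov_le; rewrite expr2; lra.
have cov_le : cov <= n%:R.
  by rewrite covE ler_nat -[X in (_ <= X)%N]card_ord max_card.
have := ler_wpM2l n0 cov_le; rewrite -expr2 => ncov_le.
have [/existsP[k /existsP[i /existsP[j /and3P[ij kiS kjS]]]]|noconf] :=
    boolP [exists k, exists i, exists j,
             [&& adj G i j, (k, i) \in S & (k, j) \in S]].
  (* An edge inside one of the sets costs n through the term n * [conf]. *)
  have conf1 : 1 <= conf.
    apply: le_trans (edge_sum_indicator_ge1 R (S := fun i => (k, i) \in S) ij kiS kjS) _.
    rewrite /conf (bigD1 k) //= lerDl; apply: sumr_ge0 => l _.
    exact: (edge_sum_indicator_ge0 R G (fun i => (l, i) \in S)).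
  have := ler_wpM2l n0 conf1; lra.
(* Otherwise, colouring each vertex by a row that contains it is proper and uses only nonempty rows.
   The default [i] never occurs, every vertex being covered. *)
pose c i := odflt i [pick k | (k, i) \in S].
have cP i : (c i, i) \in S.
  rewrite /c; case: pickP => //= nS.
  by have /existsP[k] := covered i; have /= -> := nS k.
have : (chromatic_number G <= #|[set k | [exists i, (k, i) \in S]]%SET|)%N.
  apply: (@chromatic_number_le_image _ _ _ _ c) => [i|i j ij].
    by rewrite inE; apply/existsP; exists i.
  apply: contra noconf => /eqP cij; apply/existsP; exists (c i); apply/existsP.
  by exists i; apply/existsP; exists j; rewrite ij cP cij cP.
rewrite -(ler_nat R) => chi_rows.
have -> : rows = #|[set k | [exists i, (k, i) \in S]]%SET|%:R.
  by rewrite -sum_indicator; apply: eq_bigr => i _; rewrite inE.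
lra.
Qed.

Lemma gamma_objective_le (R : realType) n (G : sgraph n) (x : 'M[R]_n) :
  x != 0 -> gamma_objective G x <= n%:R ^+ 2 - (chromatic_number G)%:R.
Proof.
move=> /mx_norm_gt0 x_gt0; rewrite gamma_objectiveE ler_pdivrMr // -subr_ge0.
pose maxf (J : finType) (h : J -> 'I_n * 'I_n) (u : 'I_n * 'I_n -> R) :=
  \big[Num.max/0]_j u (h j).
pose f (u : 'I_n * 'I_n -> R) :=
  (n%:R ^+ 2 - (chromatic_number G)%:R) * maxf _ id u
  + ((- n%:R) * \sum_i maxf _ (fun k => (k, i)) u
  + (\sum_k maxf _ (fun i => (k, i)) u
  + n%:R * \sum_k edge_sum G (fun i j => Num.min (u (k, i)) (u (k, j))))).
(* Row and column norms range over pairs with a trivial coordinate; dropping it expresses them as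
   maxima over entries of the whole matrix. *)
have colE i : mx_norm (col i x) = maxf _ (fun k => (k, i)) (fun p => `|x p.1 p.2|).
  rewrite mx_normrE; apply/le_anti/andP; split.
    apply: bigmax_le => [|p _]; first exact: bigmax_ge_id.
    by rewrite mxE; apply: (le_bigmax 0 (fun k => `|x k i|)).
  apply: bigmax_le => [|k _]; first exact: bigmax_ge_id.
  by have := le_bigmax 0 (fun p => `|col i x p.1 p.2|) (k, 0); rewrite /= mxE.
have rowE k : mx_norm (row k x) = maxf _ (fun i => (k, i)) (fun p => `|x p.1 p.2|).
  rewrite mx_normrE; apply/le_anti/andP; split.
    apply: bigmax_le => [|p _]; first exact: bigmax_ge_id.
    by rewrite mxE; apply: (le_bigmax 0 (fun i => `|x k i|)).
  apply: bigmax_le => [|i _]; first exact: bigmax_ge_id.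
  by have := le_bigmax 0 (fun p => `|row k x p.1 p.2|) (0, i); rewrite /= mxE.
suff : 0 <= f (fun p => `|x p.1 p.2|).
  rewrite (eq_bigr _ (fun i _ => colE i)) (eq_bigr _ (fun k _ => rowE k)).
  by rewrite /f mx_normrE /maxf /=; lra.
apply: layer_additive_ge0 => // [|S /finset.set0Pn[p pS]].
  apply: layer_additiveD; first exact/layer_additiveZ/layer_additive_max.
  apply: layer_additiveD.
    by apply: layer_additiveZ; apply: layer_additive_sum => i; apply: layer_additive_max.
  apply: layer_additiveD.
    by apply: layer_additive_sum => i; apply: layer_additive_max.
  apply: layer_additiveZ; apply: layer_additive_sum => k.
  exact: layer_additive_edge_sum.
rewrite /f /maxf (bigmax_indicator R (fun p => p \in S)).
have -> : [exists p, p \in S] by apply/existsP; exists p.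
have := gamma_indicator_le R G S.
rewrite -(eq_bigr _ (fun i _ => bigmax_indicator R (fun k => (k, i) \in S))).
rewrite -(eq_bigr _ (fun k _ => bigmax_indicator R (fun i => (k, i) \in S))).
by rewrite /= mulr1; lra.
Qed.

(** The witness has as its rows the colour classes of an optimal colouring, padded with empty rows.
    Every column then has norm 1, no edge lies inside a row, and the nonzero rows number at most the
    chromatic number. *)
Lemma gamma_max (R : realType) n (G : sgraph n) : (0 < n)%N ->
  is_max_nonzero (@gamma_objective R n G) (n%:R ^+ 2 - (chromatic_number G)%:R).
Proof.
move=> n_gt0; have /existsP[c /forallP cP] := chromatic_number_colorable G.
pose w i := widen_ord (chromatic_number_le_card G) (c i).
pose b k i := w i == k.
have normE m p (h : 'M[R]_n -> 'M[R]_(m, p)) (b' : 'I_m -> 'I_p -> bool) :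
    h (\matrix_(k, i) (b k i)%:R) = \matrix_(k, i) (b' k i)%:R ->
    mx_norm (h (\matrix_(k, i) (b k i)%:R)) = [exists p, b' p.1 p.2]%:R.
  by move=> ->; apply: mx_norm_indicator.
pose i0 := Ordinal n_gt0.
apply: (@is_max_nonzero_intro _ _ _ _ (\matrix_(k, i) (b k i)%:R)) => [||x].
- by apply: (@indicator_mx_neq0 _ _ _ _ (w i0) i0); apply: eqxx.
- rewrite gamma_objectiveE mx_norm_indicator.
  have -> : [exists p, b p.1 p.2].
    by apply/existsP; exists (w i0, i0); apply: eqxx.
  rewrite divr1 /edge_sum [X in _ - _ * X]big1 => [|k _].
    rewrite mulr0 subr0.
    have -> : \sum_i mx_norm (col i (\matrix_(k, i) (b k i)%:R)) = n%:R :> R.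
      rewrite -[RHS]mulr1 mulr_natl -[X in _ = _ *+ X]card_ord -sumr_const.
      apply: eq_bigr => i _.
      rewrite (normE _ _ (col i) (fun k _ => b k i)) => [|//].
        by case: existsP => // -[]; exists (w i, 0); apply: eqxx.
      by apply/matrixP => k j; rewrite !mxE.
    rewrite expr2 lerB //.
    have -> : \sum_k mx_norm (row k (\matrix_(k, i) (b k i)%:R))
        = #|[set k | [exists i, b k i]]%SET|%:R :> R.
      rewrite -sum_indicator; apply: eq_bigr => k _.
      rewrite (normE _ _ (row k) (fun _ i => b k i)); last first.
        by apply/matrixP => l j; rewrite !mxE.
      rewrite inE; congr (_%:R); congr nat_of_bool.
      by apply/existsP/existsP => [[p bp]|[i bi]]; [exists p.2|exists (0, i)].
    rewrite ler_nat -[X in (_ <= X)%N]card_ord.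
    apply: leq_trans (leq_imset_card (widen_ord (chromatic_number_le_card G)) _).
    apply/subset_leq_card/fintype.subsetP => k.
    by rewrite inE => /existsP[i /eqP <-]; apply: imset_f.
  apply: big1 => i _; apply: big1 => j /andP[_ ij]; rewrite !mxE !normr_nat.
  have : ~~ (b k i && b k j).
    apply/negP => /andP[/eqP <- /eqP] /(congr1 val) /= /val_inj cij.
    by move/forallP: (cP i) => /(_ j); rewrite ij cij eqxx.
  by case: (b k i); case: (b k j) => // _; rewrite /Num.min ?ltxx ?ltr10 ?ltr01.
exact: gamma_objective_le.
Qed.

(** * Motzkin-Straus inequality *)

(** Cauchy-Schwarz against the constant 1, obtained by expanding the nonnegative double sum of (y a
    - y b)^2. *)
Lemma sum_sq_le (R : realType) (T : finType) (K : {set T}) (y : T -> R) :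
  (\sum_(a in K) y a) ^+ 2 <= #|K|%:R * \sum_(a in K) y a ^+ 2.
Proof.
set s := \sum_(a in K) y a ^+ 2.
have E1 : \sum_(a in K) \sum_(b in K) y a ^+ 2 = #|K|%:R * s.
  by rewrite mulr_sumr; apply: eq_bigr => a _; rewrite sumr_const mulr_natl.
have E2 : \sum_(a in K) \sum_(b in K) y b ^+ 2 = #|K|%:R * s.
  by rewrite sumr_const mulr_natl.
have E3 : (\sum_(a in K) y a) ^+ 2 = \sum_(a in K) \sum_(b in K) y a * y b.
  by rewrite expr2 mulr_suml; apply: eq_bigr => a _; rewrite mulr_sumr.
have : 0 <= \sum_(a in K) \sum_(b in K) (y a - y b) ^+ 2.
  by do 2!apply: sumr_ge0 => ? _; rewrite sqr_ge0.
have -> : \sum_(a in K) \sum_(b in K) (y a - y b) ^+ 2 =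
   \sum_(a in K) \sum_(b in K) y a ^+ 2 + \sum_(a in K) \sum_(b in K) y b ^+ 2
   - 2 * \sum_(a in K) \sum_(b in K) y a * y b.
  rewrite -big_split mulr_sumr -sumrB; apply: eq_bigr => a _.
  rewrite -big_split mulr_sumr -sumrB; apply: eq_bigr => b _ /=; ring.
rewrite E1 E2 -E3; lra.
Qed.

Section MotzkinStraus.
Variables (R : realType) (T : finType) (r : rel T) (w : nat).
Hypotheses (r_sym : symmetric r) (r_irr : irreflexive r).
Hypothesis clique_le : forall K : {set T},
  {in K &, forall a b, a != b -> r a b} -> (#|K| <= w)%N.

(** Its quadratic form is the square of the total minus the products over adjacent ordered pairs; by
    irreflexivity the diagonal of [q] is 1. *)
Let q a b : R := (~~ r a b)%:R.

Lemma sum_shift (F y : T -> R) t a b :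
  \sum_c F c * (y c + t * ((c == a)%:R - (c == b)%:R))
  = \sum_c F c * y c + t * (F a - F b).
Proof.
have pick e : \sum_c F c * (c == e)%:R = F e.
  rewrite (bigD1 e) //= eqxx mulr1 big1 ?addr0 // => c /negPf ->.
  by rewrite mulr0.
rewrite -(pick a) -(pick b) -sumrB mulr_sumr -big_split /=.
apply: eq_bigr => c _; ring.
Qed.

(* Two non-adjacent vertices of the support of y are merged by shifting all the
   weight of one onto the other: along this line the quadratic form is affine,
   because q a a + q b b = q a b + q b a. *)
Lemma motzkin_straus (y : T -> R) : (forall a, 0 <= y a) ->
  (\sum_a y a) ^+ 2 <= w%:R * \sum_a \sum_b q a b * (y a * y b).
Proof.
have [k] := ubnP #|[set a | y a != 0]|; elim: k y => // k IH y.
rewrite ltnS => supp_le y0; set K := [set a | y a != 0] in supp_le.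
have q_sym a b : q a b = q b a by rewrite /q r_sym.
have q_diag a : q a a = 1 by rewrite /q r_irr.
have [noindep|] := boolP [forall a in K, forall b in K, (a != b) ==> r a b].
  (* When the support is a clique, Cauchy-Schwarz applies on at most [w] points, and the diagonal
     terms alone suffice. *)
  have K_clique : {in K &, forall a b, a != b -> r a b}.
    by move=> a b aK bK; move/forall_inP/(_ a aK)/forall_inP/(_ b bK)/implyP: noindep.
  have suppE (F : T -> R) : 
      (forall a, y a = 0 -> F a = 0) -> \sum_a F a = \sum_(a in K) F a.
    move=> F0; rewrite [RHS]big_mkcond; apply: eq_bigr => a _.
    by rewrite inE; case: eqP => [/F0 ->|].
  rewrite suppE //; apply: le_trans (sum_sq_le K y) _.
  rewrite -suppE => [|a ->]; last by rewrite expr0n.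
  apply: ler_pM; rewrite ?ler0n ?ler_nat ?clique_le //.
    by apply: sumr_ge0 => a _; apply: sqr_ge0.
  apply: ler_sum => a _; rewrite (bigD1 a) //= q_diag mul1r -expr2 lerDl.
  apply: sumr_ge0 => b _.
  by rewrite !mulr_ge0 ?ler0n.
move=> /forall_inPn[a aK] /forall_inPn[b bK]; rewrite negb_imply.
pose L c := \sum_d q c d * y d.
(* [L] is half the gradient of the form, so weight is to move towards the vertex with the smaller
   value of [L]. *)
wlog Lab : a b aK bK / L a <= L b.
  move=> H; have [/H|/ltW /H] := lerP (L a) (L b); first exact.
  by rewrite eq_sym r_sym; apply.
move=> /andP[ab nrab].
have DE z : \sum_c \sum_d q c d * (z c * z d) = \sum_c (\sum_d q c d * z d) * z c.
  by apply: eq_bigr => c _; rewrite mulr_suml; apply: eq_bigr => d _; ring.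
(* All the weight of [b] goes to [a]: the total is kept, and [b] leaves the support. *)
pose z c := y c + y b * ((c == a)%:R - (c == b)%:R).
have z_b : z b = 0 by rewrite /z eqxx eq_sym (negPf ab) /=; ring.
have z0 c : 0 <= z c.
  have [->|cb] := eqVneq c b; first by rewrite z_b.
  by rewrite /z (negPf cb) subr0 addr_ge0 ?mulr_ge0.
have sum_z : \sum_c z c = \sum_c y c.
  have := sum_shift (fun=> 1) y (y b) a b; rewrite subrr mulr0 addr0.
  by under eq_bigr do rewrite mul1r; under [RHS]eq_bigr do rewrite mul1r.
have : (\sum_c z c) ^+ 2 <= w%:R * \sum_c \sum_d q c d * (z c * z d).
  apply: IH => //; apply: leq_trans supp_le; apply/proper_card/properP; split.
    apply/fintype.subsetP => c; rewrite !inE; apply: contra_neq => yc.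
    rewrite /z yc; have [ca|_] := eqVneq c a.
      by move: aK; rewrite inE -ca yc eqxx.
    have [cb|_] := eqVneq c b; last by rewrite /=; ring.
    by move: bK; rewrite inE -cb yc eqxx.
  by exists b => //; rewrite inE z_b eqxx.
rewrite sum_z => /le_trans; apply; apply: ler_wpM2l => //.
have Lz c : \sum_d q c d * z d = L c + y b * (q c a - q c b) by apply: sum_shift.
rewrite !DE (eq_bigr (fun c => (L c + y b * (q c a - q c b)) * z c)); last first.
  by move=> c _; rewrite Lz.
(* The terms quadratic in [y b] cancel, so the form changes by 2 * y b * (L a - L b), which is at
   most 0. *)
rewrite (sum_shift (fun c => L c + y b * (q c a - q c b))) !q_diag.
have -> : q a b = 1 by rewrite /q nrab.
have -> : q b a = 1 by rewrite q_sym /q nrab.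
have -> : \sum_c (L c + y b * (q c a - q c b)) * y c
    = \sum_c L c * y c + y b * (L a - L b).
  rewrite /L -sumrB mulr_sumr -big_split /=; apply: eq_bigr => c _.
  rewrite (q_sym a c) (q_sym b c); ring.
have := mulr_ge0 (y0 b) (_ : 0 <= L b - L a); rewrite subr_ge0 => /(_ Lab).
rewrite -/(L _); lra.
Qed.

End MotzkinStraus.

(** * Matching number *)

Section Matching.
Variables (R : realType) (n : nat) (G : sgraph n).
Implicit Types (a b : 'I_#|edges G|).

Definition edge_disjoint : rel 'I_#|edges G| :=
  fun a b => [disjoint enum_val a & enum_val b].

Lemma edge_disjointC : symmetric edge_disjoint.
Proof. by move=> a b; rewrite /edge_disjoint disjoint_sym. Qed.

Lemma edge_disjoint_irr : irreflexive edge_disjoint.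
Proof.
move=> a; rewrite /edge_disjoint -setI_eq0 finset.setIid -cards_eq0.
by rewrite (card_edge (enum_valP a)).
Qed.

Lemma edge_clique_le (K : {set 'I_#|edges G|}) :
  {in K &, forall a b, a != b -> edge_disjoint a b} ->
  (#|K| <= matching_number G)%N.
Proof.
move=> Kdisj; rewrite -(card_imset _ enum_val_inj).
apply: (@leq_bigmax_cond _ (is_matching G) (fun M => #|M|)).
apply/andP; split.
  by apply/fintype.subsetP => _ /imsetP[a _ ->]; apply: enum_valP.
apply/forall_inP => _ /imsetP[a aK ->]; apply/forall_inP => _ /imsetP[b bK ->].
by apply/implyP; rewrite (inj_eq enum_val_inj); apply: Kdisj.
Qed.

(** The denominator of the objective becomes the Motzkin-Straus form: by symmetry, doubling the sum
    over a < b covers all ordered disjoint pairs, and no edge is disjoint from itself. *)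
Lemma sq_sum_sub_disjoint (z : 'I_#|edges G| -> R) :
  (\sum_a z a) ^+ 2 - 2 * \sum_(a < #|edges G|)
     \sum_(b < #|edges G| | (a < b)%N && edge_disjoint a b) z a * z b
  = \sum_a \sum_b (~~ edge_disjoint a b)%:R * (z a * z b).
Proof.
set P := \sum_(a < _) _.
have PE : P = \sum_(a < #|edges G|)
    \sum_(b < #|edges G| | (b < a)%N && edge_disjoint a b) z a * z b.
  rewrite [RHS](exchange_big_dep xpredT) //=; apply: eq_bigr => a _.
  by apply: eq_big => [b|b _]; rewrite 1?edge_disjointC // mulrC.
have -> : 2 * P = \sum_a \sum_b (edge_disjoint a b)%:R * (z a * z b).
  rewrite mulr_natl mulr2n {2}PE /P -big_split /=; apply: eq_bigr => a _.
  rewrite big_mkcond [X in _ + X]big_mkcond -big_split /=; apply: eq_bigr => b _.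
  have [ab|ba|/val_inj ->] := ltngtP a b.
  - by case: (edge_disjoint a b); rewrite ?mul1r ?mul0r addr0.
  - by case: (edge_disjoint a b); rewrite ?mul1r ?mul0r add0r.
  - by rewrite edge_disjoint_irr !mul0r addr0.
rewrite expr2 mulr_suml -sumrB; apply: eq_bigr => a _.
rewrite mulr_sumr -sumrB; apply: eq_bigr => b _.
by case: (edge_disjoint a b); rewrite /= ?mul1r ?mul0r ?subrr ?subr0.
Qed.

Lemma norm1_row k (y : 'rV[R]_k) : norm1 y = \sum_j `|y 0 j|.
Proof. by rewrite /norm1 big_ord1. Qed.

Lemma matching_objective_le (y : 'rV[R]_#|edges G|) :
  y != 0 -> matching_objective y <= (matching_number G)%:R.
Proof.
move=> y0; rewrite /matching_objective; set D := _ - _.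
have s_gt0 : 0 < norm1 y ^+ 2.
  have /rV0Pn[i yi] := y0; rewrite exprn_gt0 // norm1_row (bigD1 i) //=.
  by rewrite ltr_pwDl ?normr_gt0 // sumr_ge0.
(* Replacing [y] by its absolute values keeps the norm and can only lower the denominator, so the
   nonnegative case suffices. *)
have sD : norm1 y ^+ 2 <= (matching_number G)%:R * D.
  rewrite norm1_row; apply: le_trans (motzkin_straus edge_disjointC
    edge_disjoint_irr edge_clique_le (fun a => normr_ge0 (y 0 a))) _.
  apply: ler_wpM2l => //; rewrite -sq_sum_sub_disjoint /D norm1_row.
  rewrite lerD2l lerN2 ler_wpM2l //; do 2!apply: ler_sum => ? _.
  by rewrite -normrM ler_norm.
(* A nonpositive denominator would contradict [sD], whose left side is positive. *)
have D_gt0 : 0 < D.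
  rewrite ltNge; apply/negP => D0; have := lt_le_trans s_gt0 sD.
  by rewrite ltNge mulr_ge0_le0.
by rewrite ler_pdivrMr.
Qed.

(** At the indicator of a maximum matching [M], distinct members are disjoint, so only the diagonal
    of the form survives and the quotient is #|M|^2 / #|M|. A single edge is a matching, hence [M]
    is nonempty. *)
Lemma matching_max : (0 < #|edges G|)%N ->
  is_max_nonzero (@matching_objective R n G) (matching_number G)%:R.
Proof.
move=> edges_gt0.
have [|M matM cardM] := @eq_bigmax_cond _ (is_matching G) (fun M => #|M|).
  apply/card_gt0P; exists finset.set0; apply/andP; split; first exact: finset.sub0set.
  by apply/forall_inP => e; rewrite inE.
have M_gt0 : (0 < #|M|)%N.
  have /card_gt0P[e eG] := edges_gt0.
  rewrite -cardM -(cards1 e).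
  apply: (@leq_bigmax_cond _ (is_matching G) (fun M => #|M|)).
  apply/andP; split; first by rewrite finset.sub1set.
  apply/forall_inP => _ /set1P ->; apply/forall_inP => _ /set1P ->.
  by rewrite eqxx.
have /andP[MG /forall_inP Mdisj] := matM.
have [e eM] := card_gt0P M_gt0.
pose m a : R := (enum_val a \in M)%:R.
have sum_m : \sum_a m a = #|M|%:R.
  have <- : \sum_(e in edges G) (e \in M)%:R = \sum_a m a by apply: big_enum_val.
  rewrite -sum_indicator [RHS](bigID (fun e => e \in edges G)) /=.
  rewrite [X in _ + X]big1 ?addr0 // => e' e'G.
  by have [/(fintype.subsetP MG)|//] := boolP (e' \in M); rewrite (negPf e'G).
pose y : 'rV[R]_#|edges G| := \row_a m a.
have norm_y : norm1 y = #|M|%:R.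
  by rewrite norm1_row -sum_m; apply: eq_bigr => a _; rewrite mxE normr_nat.
apply: (@is_max_nonzero_intro _ _ _ _ y) => [||x].
- apply: contraTneq M_gt0 => y0; rewrite -leqNgt -(ler_nat R) -norm_y y0.
  by rewrite norm1_row big1 // => i _; rewrite mxE normr0.
- rewrite /matching_objective norm_y.
  have -> : \sum_(a < #|edges G|) \sum_(b < #|edges G| |
       (a < b)%N && [disjoint enum_val a & enum_val b]) y 0 a * y 0 b
     = \sum_(a < #|edges G|) \sum_(b < #|edges G| |
       (a < b)%N && edge_disjoint a b) m a * m b.
    by do 2!apply: eq_bigr => ? _; rewrite !mxE.
  rewrite -{2}sum_m sq_sum_sub_disjoint.
  have -> : \sum_a \sum_b (~~ edge_disjoint a b)%:R * (m a * m b) = \sum_a m a.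
    apply: eq_bigr => a _; rewrite (bigD1 a) //= edge_disjoint_irr mul1r.
    rewrite big1 ?addr0 => [|b ba].
      by rewrite /m; case: (_ \in M); rewrite ?mul1r ?mul0r.
    rewrite /m; have [aM|] := boolP (enum_val a \in M); last by rewrite mul0r mulr0.
    have [bM|] := boolP (enum_val b \in M); last by rewrite !mulr0.
    have /forall_inP/(_ _ bM)/implyP := Mdisj _ aM.
    rewrite (inj_eq enum_val_inj) eq_sym => /(_ ba).
    by rewrite /edge_disjoint => ->; rewrite mul0r.
  rewrite sum_m expr2 mulfK ?pnatr_eq0 -?lt0n // /matching_number cardM.
  exact: lexx.
exact: matching_objective_le.
Qed.

End Matching.

(** The positivity conditions on [n] and on the number of edges provide the nonzero vectors over
    which the maxima are taken. *)
Theorem theoremB (R : realType) (n : nat) (n_gt0 : (0 < n)%N) (G : sgraph n) :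
  [/\ is_max_nonzero (@alpha_objective R n G) (independence_number G)%:R,
      exists2 m : R, is_max_nonzero (@gamma_objective R n G) m
                   & (chromatic_number G)%:R = n%:R ^+ 2 - m
    & (0 < #|edges G|)%N ->
      is_max_nonzero (@matching_objective R n G) (matching_number G)%:R].
Proof.
split; [exact: alpha_max | | exact: matching_max].
by exists (n%:R ^+ 2 - (chromatic_number G)%:R); [exact: gamma_max | rewrite subKr].
Qed.
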